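(* Let $c(x,y)=|x-y|^2$ on $\mathbb{R}^d\times\mathbb{R}^d$. Let $\mu,\nu\in\mathcal{P}_2(\mathbb{R}^d)$ and assume that at least one of $\mu$ and $\nu$ satisfies the Logarithmic Sobolev inequality with some constant $K>0$. Let $\{\Lambda_n\}$ be a positive increasing sequence with $\lim_{n\to\infty}\Lambda_n=+\infty$. Then the sequence of functionals $\{\mathcal{E}_{\Lambda_n,\mathrm{KL}}(\cdot|\mu,\nu)\}$ $\Gamma$-converges to $\mathcal{E}_{\iota}(\cdot|\mu,\nu)$ on $\mathcal{P}_2(\mathbb{R}^d\times\mathbb{R}^d)$ equipped with the topology of weak convergence.
   Context: For $X=\mathbb{R}^m$, $\mathcal{P}_2(X)=\{\gamma\in\mathcal{P}(X):\gamma\ll\mathscr{L}^m,\ \int_X|x|^2d\gamma<+\infty\}$, where $\mathcal{P}(X)$ is the set of probability measures on $X$ and $\mathscr{L}^m$ is Lebesgue measure. $\pi_1,\pi_2$ are the projections of $\mathbb{R}^d\times\mathbb{R}^d$ onto the first and second factors and $\#$ denotes push-forward. For finite positive measures $\alpha,\beta$ on $\mathbb{R}^d$, $D_{\mathrm{KL}}(\alpha\|\beta)=\int F(\frac{d\alpha}{d\beta})\,d\beta$ with $F(s)=s\log s-s+1$ (and $F(0)=1$) if $\alpha\ll\beta$, and $+\infty$ otherwise. For $\Lambda>0$, $$\mathcal{E}_{\Lambda,\mathrm{KL}}(\gamma|\mu,\nu)=\iint c(x,y)\,d\gamma(x,y)+\Lambda D_{\mathrm{KL}}(\pi_{1\#}\gamma\|\mu)+\Lambda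 D_{\mathrm{KL}}(\pi_{2\#}\gamma\|\nu).$$ Let $\iota(s)=0$ if $s=1$ and $\iota(s)=+\infty$ if $s\ne1$, and $$\mathcal{E}_{\iota}(\gamma|\mu,\nu)=\iint c(x,y)\,d\gamma(x,y)+\int\iota\left(\frac{d\pi_{1\#}\gamma}{d\mu}\right)d\mu+\int\iota\left(\frac{d\pi_{2\#}\gamma}{d\nu}\right)d\nu,$$ where each of the last two terms is $+\infty$ if the corresponding absolute continuity ($\pi_{1\#}\gamma\ll\mu$, resp. $\pi_{2\#}\gamma\ll\nu$) fails. Thus $\mathcal{E}_\iota(\gamma|\mu,\nu)=\iint c\,d\gamma$ if $\pi_{1\#}\gamma=\mu$ and $\pi_{2\#}\gamma=\nu$, and $+\infty$ otherwise. A probability measure $\mu$ on $\mathbb{R}^d$ satisfies the Logarithmic Sobolev inequality with constant $K>0$ if for every probability measure $\tilde\mu\ll\mu$, $D_{\mathrm{KL}}(\tilde\mu\|\mu)\le\frac{1}{2K}I(\tilde\mu|\mu)$, where $I(\tilde\mu|\mu)=\int|\nabla\log(\frac{d\tilde\mu}{d\mu})|^2d\tilde\mu$ is the Fisher information. On a first countable space, $F_n$ $\Gamma$-converges to $F$ if: (i) for every $x$ there is a sequence $x_n\to x$ with $\limsup_n F_n(x_n)\le F(x)$; and (ii) for every sequence $x_n\to x$, $\liminf_n F_n(x_n)\ge F(x)$. *)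

(* Defs.v *)
From HB Require Import structures.
From mathcomp Require Import all_boot all_order all_algebra.
From mathcomp Require Import all_classical all_reals all_analysis.
From mathcomp Require Import measurable_realfun.

Set Implicit Arguments.
Unset Strict Implicit.
Unset Printing Implicit Defensive.

Import Order.TTheory GRing.Theory Num.Theory.
Import numFieldNormedType.Exports.

Local Open Scope classical_set_scope.
Local Open Scope charge_scope.
Local Open Scope ring_scope.

Definition borel_rV_display : measure_display.
Proof. exact: default_measure_display. Qed.

Section borel_rV.
Context {R : realType} {n : nat}.

Let borel0 : <<s @open 'rV[R]_n >> set0.
Proof. exact: sigma_algebra0. Qed.

Let borelC A : <<s @open 'rV[R]_n >> A -> <<s @open 'rV[R]_n >> (~` A).
Proof. exact: sigma_algebraC. Qed.

Let borel_bigcup (F : (set 'rV[R]_n)^nat) :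
  (forall i, <<s @open 'rV[R]_n >> (F i)) ->
  <<s @open 'rV[R]_n >> (\bigcup_i F i).
Proof. exact: sigma_algebra_bigcup. Qed.

(* 'rV[R]_n carries its Borel sigma-algebra; products 'rV[R]_n * 'rV[R]_n get
   the product sigma-algebra, which is again the Borel one (second
   countability). *)
HB.instance Definition _ := @isMeasurable.Build borel_rV_display
  'rV[R]_n <<s @open 'rV[R]_n >> borel0 borelC borel_bigcup.

Lemma open_measurable_rV (A : set 'rV[R]_n) : open A -> measurable A.
Proof. by move=> oA; exact: sub_sigma_algebra. Qed.

Lemma measurable_coord (i : 'I_n) :
  measurable_fun [set: 'rV[R]_n] (fun v : 'rV[R]_n => v ord0 i).
Proof.
apply: (measurability _ (RGenOpens.measurableE R)) => _ [_ [a [b ->] <-]].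
rewrite setTI; apply: open_measurable_rV.
by apply: open_comp => [? _|]; [exact: coord_continuous|exact: interval_open].
Qed.

Lemma open_rV_bigcup_ball (A : set 'rV[R]_n) : open A ->
  A = \bigcup_(p in [set p : 'rV[rat]_n * nat |
        ball (map_mx ratr p.1 : 'rV[R]_n) p.2.+1%:R^-1 `<=` A])
        ball (map_mx ratr p.1 : 'rV[R]_n) p.2.+1%:R^-1.
Proof.
move=> oA; apply/seteqP; split=> [x Ax|x [p /= pA]]; last exact: pA.
have /nbhs_ballP[e /= e0 eA] : nbhs x A by exact: open_nbhs_nbhs.
pose k := Num.truncn (2 / e).
have k0 : 0 < k.+1%:R^-1 :> R by rewrite invr_gt0.
have ke : k.+1%:R^-1 < e / 2.
  rewrite invf_plt ?posrE ?divr_gt0// invf_div.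
  by rewrite /k truncnS_gt.
have qP (i : 'I_n) : {q : rat | ball (x ord0 i) k.+1%:R^-1 (ratr q : R)}.
  apply/cid; have [||y [ye [q _ qy]]] := @dense_rat R (ball (x ord0 i) k.+1%:R^-1).
  - by exists (x ord0 i); exact: ballxx.
  - exact: ball_open.
  - by exists q; rewrite qy.
pose q : 'rV[rat]_n := \row_i sval (qP i).
have xq : ball x k.+1%:R^-1 (map_mx ratr q : 'rV[R]_n).
  by split=> // a i; rewrite ord1 !mxE; case: (qP i).
exists (q, k) => /=; last exact/ball_sym.
move=> y qy; apply: eA; have := ball_triangle xq qy.
by apply: le_ball; rewrite [leRHS]splitr lerD ?ltW.
Qed.

Lemma measurable_fun_rV d (T : measurableType d) (f : T -> 'rV[R]_n) :
  (forall i, measurable_fun [set: T] (fun x => f x ord0 i)) ->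
  measurable_fun [set: T] f.
Proof.
move=> mf; apply: (@measurability _ _ _ _ _ _ (@open 'rV[R]_n)); first by [].
move=> _ [A oA <-]; rewrite setTI (open_rV_bigcup_ball oA) preimage_bigcup.
rewrite bigcup_mkcond; apply: countable_bigcupT_measurable => // p.
case: ifPn => // _; rewrite [X in measurable X](_ : _ =
    \big[setI/setT]_(i < n) ((fun x => f x ord0 i) @^-1`
      ball (ratr (p.1 ord0 i) : R) p.2.+1%:R^-1)).
  apply: bigsetI_measurable => i _; rewrite -[X in measurable X]setTI.
  by apply: mf => //; apply: open_measurable; exact: ball_open.
apply/seteqP; split=> [x [_ px]|x px].
  by rewrite -bigcap_seq => i _ /=; have := px ord0 i; rewrite mxE.
split=> [|a i]; first by rewrite invr_gt0.
rewrite ord1 mxE; move: px; rewrite -bigcap_seq; apply.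
exact: mem_index_enum.
Qed.
End borel_rV.

Section lebesgue_rV.
Context {R : realType}.

Definition rV_cons n (p : measurableTypeR R * 'rV[R]_n) : 'rV[R]_n.+1 :=
  row_mx (const_mx p.1 : 'M[R]_1) p.2.

Lemma measurable_rV_cons n : measurable_fun setT (@rV_cons n).
Proof.
apply: measurable_fun_rV => i.
rewrite -(splitK (i : 'I_(1 + n))); case: (fintype.split _) => j /=.
  rewrite (_ : (fun _ => _) = fst)//; apply/funext => p.
  by apply: etrans (row_mxEl _ _ _ _) _; rewrite mxE.
rewrite (_ : (fun _ => _) = (fun v : 'rV_n => v ord0 j) \o snd); last first.
  by apply/funext => p; exact: row_mxEr.
by apply: measurableT_comp => //; exact: measurable_coord.
Qed.

HB.instance Definition _ n :=
  isMeasurableFun.Build _ _ _ _ (@rV_cons n) (@measurable_rV_cons n).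

Section lebesgue_succ.
Variable n : nat.
Variable m : {sigma_finite_measure set 'rV[R]_n -> \bar R}.

Definition lebesgue_succ : set 'rV[R]_n.+1 -> \bar R :=
  pushforward (lebesgue_measure \x m)%E (@rV_cons n).

Let lebesgue_succ0 : lebesgue_succ set0 = 0%E.
Proof. exact: measure0. Qed.

Let lebesgue_succ_ge0 A : (0 <= lebesgue_succ A)%E.
Proof. exact: measure_ge0. Qed.

Let lebesgue_succ_sigma_additive : semi_sigma_additive lebesgue_succ.
Proof. by apply: measure_semi_sigma_additive; exact: measurable_rV_cons. Qed.

HB.instance Definition _ := isMeasure.Build _ _ _ lebesgue_succ
  lebesgue_succ0 lebesgue_succ_ge0 lebesgue_succ_sigma_additive.

Let lebesgue_succ_sigma_finite : sigma_finite setT lebesgue_succ.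
Proof.
pose uncons (v : 'rV[R]_n.+1) : (measurableTypeR R * 'rV[R]_n)%type :=
  (v ord0 ord0, rsubmx (v : 'rV_(1 + n))).
have consK : cancel (@rV_cons n) uncons.
  case=> x v; rewrite /uncons /rV_cons row_mxKr; congr pair.
  rewrite (_ : ord0 = lshift n (ord0 : 'I_1)); last exact: val_inj.
  by apply: etrans (row_mxEl _ _ _ _) _; rewrite mxE.
have munc : measurable_fun setT uncons.
  apply/measurable_fun_pairP; split; first exact: measurable_coord.
  apply: measurable_fun_rV => i.
  rewrite (_ : (fun _ => _) = fun v : 'rV_n.+1 => v ord0 (rshift 1 i)).
    exact: measurable_coord.
  by apply/funext => v; rewrite mxE.
have /sigma_finiteP[G [TG ndG Goo]] := sigma_finiteT (@lebesgue_measure R).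
have /sigma_finiteP[H [TH ndH Hoo]] := sigma_finiteT m.
pose F k := G k `*` H k.
have FT : setT = \bigcup_k F k.
  rewrite -setXTT TG TH predeqE => -[x y]; split.
    move=> [/= [k _ Gkx] [l _ Hly]]; exists (maxn k l) => //; split.
    - by move: x Gkx; exact/subsetPset/ndG/leq_maxl.
    - by move: y Hly; exact/subsetPset/ndH/leq_maxr.
  by move=> [k _ []/= ? ?]; split; exists k.
have mF k : measurable (F k) /\ ((lebesgue_measure \x m) (F k) < +oo)%E.
  have [? ?] := Goo k; have [? ?] := Hoo k; split; first exact: measurableX.
  by rewrite product_measure1E// lte_mul_pinfty// ge0_fin_numE.
exists (fun k => uncons @^-1` F k).
  by rewrite -preimage_bigcup -FT preimage_setT.
move=> k; have [mFk Fkoo] := mF k; split.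
  by rewrite -[X in measurable X]setTI; exact: munc.
rewrite /lebesgue_succ /pushforward -comp_preimage (_ : uncons \o _ = id) ?preimage_id //.
by apply/funext => p /=; rewrite consK.
Qed.

HB.instance Definition _ := Measure_isSigmaFinite.Build _ _ _ lebesgue_succ
  lebesgue_succ_sigma_finite.

End lebesgue_succ.

(* n-dimensional Lebesgue measure, by iterated products with the Lebesgue measure
   of the line. *)
Fixpoint lebesgue_rV n : {sigma_finite_measure set 'rV[R]_n -> \bar R} :=
  match n with
  | 0%N => \d_(0 : 'rV[R]_0)
  | k.+1 => lebesgue_succ (lebesgue_rV k)
  end.

End lebesgue_rV.

HB.instance Definition _ d1 d2 (T1 : measurableType d1) (T2 : measurableType d2) :=
  isMeasurableFun.Build _ _ _ _ (@fst T1 T2) measurable_fst.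
HB.instance Definition _ d1 d2 (T1 : measurableType d1) (T2 : measurableType d2) :=
  isMeasurableFun.Build _ _ _ _ (@snd T1 T2) measurable_snd.

(* The library norm on 'rV[R]_n is the sup norm; this is the squared Euclidean
   norm. *)
Definition sqnorm {R : realType} n (x : 'rV[R]_n) : R :=
  \sum_(i < n) x ord0 i ^+ 2.

(* Absolutely continuous probability measures with finite second moment; L is
   the reference (Lebesgue) measure and nrm2 the squared Euclidean norm. *)
Definition P2 {d} {T : measurableType d} {R : realType}
    (L : set T -> \bar R) (nrm2 : T -> R) : set (probability T R) :=
  [set g : probability T R | g `<< L /\ (\int[g]_x (nrm2 x)%:E < +oo)%E].

Definition P2_rV {R : realType} n : set (probability 'rV[R]_n R) :=
  P2 (lebesgue_rV n) (@sqnorm R n).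

(* R^n x R^n is identified with R^(2n): its Lebesgue measure is the product one
   and |(x, y)|^2 = |x|^2 + |y|^2. *)
Definition P2_rV2 {R : realType} n :
    set (probability ('rV[R]_n * 'rV[R]_n)%type R) :=
  P2 (lebesgue_rV n \x lebesgue_rV n)%E (fun z => sqnorm z.1 + sqnorm z.2).

Definition P2_space (R : realType) n : Type := {g | @P2_rV2 R n g}.

HB.instance Definition _ (R : realType) n := gen_eqMixin (P2_space R n).
HB.instance Definition _ (R : realType) n := gen_choiceMixin (P2_space R n).

Definition Cb (X : topologicalType) (R : realType) : Type :=
  {f : X -> R | continuous f /\ bounded_fun f}.

HB.instance Definition _ (X : topologicalType) (R : realType) :=
  gen_eqMixin (Cb X R).
HB.instance Definition _ (X : topologicalType) (R : realType) :=
  gen_choiceMixin (Cb X R).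

Definition integrate_Cb {R : realType} n (g : P2_space R n) :
    prod_topology (fun _ : Cb ('rV[R]_n * 'rV[R]_n)%type R => R) :=
  fun f => (\int[sval g]_z sval f z)%R.

(* Topology of weak (narrow) convergence: the coarsest one making every
   g |-> \int f dg, f bounded continuous, continuous. *)
HB.instance Definition _ (R : realType) n :=
  Topological.copy (P2_space R n) (initial_topology (@integrate_Cb R n)).

(* Sequential Gamma-convergence, meant for first countable X. *)
Definition Gamma_cvg {R : realType} (X : topologicalType)
    (F : nat -> X -> \bar R) (F0 : X -> \bar R) : Prop :=
  (forall x : X, exists2 u : nat -> X, u @ \oo --> x &
     (limn_esup (fun n => F n (u n)) <= F0 x)%E) /\
  (forall (x : X) (u : nat -> X), u @ \oo --> x ->
     (F0 x <= limn_einf (fun n => F n (u n)))%E).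

Section divergence.
Context {d} {T : measurableType d} {R : realType}.
Local Open Scope ereal_scope.

(* \int F(da/db) db, and +oo unless a << b; 'd a '/d b is finite everywhere
   when a << b, so fine loses nothing. *)
Definition divergence (F : R -> \bar R)
    (a b : {finite_measure set T -> \bar R}) : \bar R :=
  if `[< a `<< b >] then
    \int[b]_x F (fine ('d (charge_of_finite_measure a) '/d b x))
  else +oo.

(* ln 0 = 0 here, so the value at 0 is 1. *)
Definition KL_integrand (s : R) : \bar R := (s * ln s - s + 1)%R%:E.

Definition KL := divergence KL_integrand.

Definition iota_constraint (s : R) : \bar R := if s == 1%R then 0 else +oo.

End divergence.

Section energies.
Context {R : realType} {n : nat}.
Implicit Types (mu nu : probability 'rV[R]_n R).
Implicit Types g : probability ('rV[R]_n * 'rV[R]_n)%type R.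
Local Open Scope ereal_scope.

Definition cost (z : 'rV[R]_n * 'rV[R]_n) : R := sqnorm (z.1 - z.2).

Definition marginal1 g : probability 'rV[R]_n R := distribution g fst.
Definition marginal2 g : probability 'rV[R]_n R := distribution g snd.

Definition energy_KL (Lam : R) mu nu g : \bar R :=
  \int[g]_z (cost z)%:E + Lam%:E * KL (marginal1 g) mu
                        + Lam%:E * KL (marginal2 g) nu.

Definition energy_iota mu nu g : \bar R :=
  \int[g]_z (cost z)%:E + divergence iota_constraint (marginal1 g) mu
                        + divergence iota_constraint (marginal2 g) nu.

End energies.

Section log_sobolev.
Context {R : realType} {n : nat}.
Notation E := 'rV[R]_n.

Definition partial (i : 'I_n) (f : E -> R) : E -> R :=
  fun x => 'D_(delta_mx ord0 i) f x.

Fixpoint Ck (k : nat) (f : E -> R) : Prop :=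
  continuous f /\
  (if k is k'.+1 then forall i : 'I_n,
     (forall x, derivable f x (delta_mx ord0 i)) /\ Ck k' (partial i f)
   else True).

(* C_c^oo *)
Definition test_function (f : E -> R) : Prop :=
  (forall k, Ck k f) /\ compact (closure [set x | f x != 0]).

Definition L1loc (f : E -> R) : Prop :=
  measurable_fun [set: E] f /\
  forall K, compact K -> (lebesgue_rV n).-integrable K (EFin \o f).

(* g is the distributional gradient of f, f in W^{1,1}_loc(R^n). *)
Definition weak_gradient (f : E -> R) (g : E -> E) : Prop :=
  [/\ L1loc f, (forall i, L1loc (fun x => g x ord0 i)) &
   forall phi i, test_function phi ->
    (\int[lebesgue_rV n]_x (f x * partial i phi x) =
     - \int[lebesgue_rV n]_x (g x ord0 i * phi x))%R].

(* \int |grad log f|^2 d tmu where f = d tmu / d mu and grad log f = grad f / f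
   (f > 0 tmu-almost everywhere). The gradient is the distributional one of a
   representative of the density in W^{1,1}_loc(R^n); the value is +oo (infimum
   of the empty set) if there is none. For mu << Lebesgue, any two such
   representatives have the same gradient mu-almost everywhere, so the infimum
   ranges over at most one value. An almost-everywhere pointwise gradient would
   not do: it vanishes for every step function. *)
Definition Fisher_information (tmu mu : probability E R) : \bar R :=
  ereal_inf [set I | exists f : E -> R, exists g : E -> E,
    [/\ {ae mu, forall x, (f x)%:E = 'd (charge_of_finite_measure tmu) '/d mu x},
        weak_gradient f g &
        I = (\int[tmu]_x (sqnorm ((f x)^-1 *: g x))%:E)%E]].

Definition log_Sobolev (K : R) (mu : probability E R) : Prop :=
  forall tmu : probability E R, tmu `<< mu ->
  (KL tmu mu <= ((2 * K)^-1)%:E * Fisher_information tmu mu)%E.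

End log_sobolev.

(* Main.v *)
(* The Gamma-limsup uses constant sequences.  For the Gamma-liminf, if x has the
   prescribed marginals the inequality is lower semicontinuity of the transport
   cost, obtained by truncating the cost.  Otherwise some bounded continuous f
   separates a marginal of x from mu (or nu).  Testing the Young-type inequality
   u (s - 1) <= s ln s - s + 1 + 2 u^2 with u proportional to f bounds the
   KL divergence of the marginals of u_n below by a positive constant for n
   large, so that the energies tend to +oo. *)

Require Import Defs.
From mathcomp Require Import all_boot all_order all_algebra.
From mathcomp Require Import all_classical all_reals all_analysis.
From mathcomp Require Import measurable_realfun ring lra.

Set Implicit Arguments.
Unset Strict Implicit.
Unset Printing Implicit Defensive.

Import Order.TTheory GRing.Theory Num.Theory.
Import numFieldNormedType.Exports.
Local Open Scope classical_set_scope.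
Local Open Scope ring_scope.

(** * An entropy inequality and a comparison of lower limits *)

(** For [s > 0], [expR_ge1Dx] at [u - ln s] gives Young's inequality
    [u * s <= s * ln s - s + expR u]; it remains to bound [expR u] to second order, which is where
    the restriction on [u] enters. *)
Lemma mulr_sub1_le_entropy (R : realType) (s u : R) : `|u| <= 2^-1 ->
  u * (s - 1) <= s * ln s - s + 1 + 2 * u ^+ 2.
Proof.
rewrite ler_norml => /andP[u1 u2].
have expu : expR u <= 1 + u + 2 * u ^+ 2.
  have := expR_ge1Dx (- u); rewrite expRN => h.
  have e0 := expR_gt0 u.
  have h1 : (1 - u) * expR u <= 1 by rewrite -ler_pdivlMr// div1r.
  have h2 : 0 < 1 - u by lra.
  (* The product [(1 - u) * (1 + u + 2 * u ^+ 2)] equals [1 + u ^+ 2 * (1 - 2 * u)], which is at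
     least 1 since [u <= 1/2]. *)
  rewrite -(ler_pM2l h2); apply: (le_trans h1).
  nra.
(* Here [ln s = 0] by convention, and the claim becomes [(1 + u) * (s - 1) <= 2 * u ^+ 2], whose
   left side is negative. *)
have [s0|s0] := leP s 0; first by rewrite ln0//; nra.
have := expR_ge1Dx (u - ln s).
rewrite expRB lnK ?posrE// ler_pdivlMr// => h.
nra.
Qed.

Lemma le_cvg_limn_einf (R : realType) (u v : (\bar R)^nat) (l : \bar R) :
  v @ \oo --> l -> (\forall n \near \oo, v n <= u n)%E -> (l <= limn_einf u)%E.
Proof.
move=> vl [N _ vu]; rewrite limn_einf_lim -(cvg_lim _ (cvg_einfs vl))//.
apply: lee_lim; [exact: is_cvg_einfs|exact: is_cvg_einfs|].
exists N => // m /= Nm; apply: le_ereal_inf_tmp => _ [p /= pm <-].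
apply: (@le_trans _ _ (v p)); last by apply: vu; exact: leq_trans pm.
by apply: ereal_inf_lbound; exists p.
Qed.

(** * Continuous and bounded functions on row vectors *)

Lemma continuous_rV_measurable (R : realType) n (f : 'rV[R]_n -> R) :
  continuous f -> measurable_fun [set: 'rV[R]_n] f.
Proof.
move=> cf; apply: (measurability _ (RGenOpens.measurableE R)) => _ [_ [a [b ->] <-]].
rewrite setTI; apply: open_measurable_rV.
by apply: open_comp => [? _|]; [exact: cf|exact: interval_open].
Qed.

Lemma bounded_fun_le (T : Type) (R : realType) (f : T -> R) (M : R) :
  (forall x, `|f x| <= M) -> bounded_fun f.
Proof.
move=> fM; exists M; split; first exact: num_real.
by move=> r /ltW Mr x _; exact: le_trans (fM x) Mr.
Qed.

Lemma bounded_probability_integrable d (T : measurableType d) (R : realType)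
    (P : probability T R) (f : T -> R) :
  measurable_fun setT f -> bounded_fun f -> P.-integrable setT (EFin \o f).
Proof.
move=> mf bf; apply: measurable_bounded_integrable => //.
by rewrite -ge0_fin_numE // fin_num_measure.
Qed.

(** The function is the distance to the complement of [A], positive exactly on [A] because [A] is
    open. *)
Lemma open_cozero (R : realType) n (A : set 'rV[R]_n) : open A ->
  exists2 g : 'rV[R]_n -> R, continuous g &
    (forall x, 0 <= g x) /\ (forall x, A x <-> 0 < g x).
Proof.
(* The whole space is treated apart: the distance to the empty set is [+oo], which [fine] would turn
   into 0. *)
move=> oA; have [AT|/set0P[c Ac]] := eqVneq (~` A) set0.
  exists (cst 1); first by move=> x; exact: cst_continuous.
  split=> x /=; first exact: ler01.
  split=> _; first exact: ltr01.
  by apply: contrapT => Ax; have : set0 x by rewrite -AT.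
have dfin x : edist_inf (~` A) x \is a fin_num.
  rewrite ge0_fin_numE ?edist_inf_ge0//; apply: le_lt_trans.
    by apply: ereal_inf_lbound; exists c.
  rewrite -ge0_fin_numE ?edist_ge0//; apply/edist_finP => /=.
  exists (1 + \sum_i `|x ord0 i - c ord0 i|).
    by rewrite ltr_pwDl// sumr_ge0.
  split=> [|a i]; first by rewrite ltr_pwDl// sumr_ge0.
  rewrite ord1 /ball /= (bigD1 i)//= addrCA ltr_pwDr// ?lexx//.
  by rewrite ltr_pwDl// sumr_ge0.
exists (fun x => fine (edist_inf (~` A) x)).
  move=> x; apply: fine_cvg; first exact: nbhs_filter.
  by rewrite fineK//; exact: edist_inf_continuous.
split=> [x|x]; first by rewrite fine_ge0// edist_inf_ge0.
split=> [Ax|].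
  have /nbhs_ballP[e /= e0 eA] : nbhs x A by exact: open_nbhs_nbhs.
  rewrite -lte_fin fineK//; apply: (@lt_le_trans _ _ e%:E); first by rewrite lte_fin.
  apply: le_ereal_inf_tmp => _ [y /= Ay <-]; rewrite leNgt; apply/negP => /edist_lt_ball.
  by move=> /eA.
by move=> g0; apply: contrapT => Ax; move: g0; rewrite edist_inf0// ltxx.
Qed.

(** * Lower bounds for the Kullback-Leibler divergence *)

(** The entropy inequality is integrated against [b], with [s] the density of [a] and [u = f x]. The
    change of variables turns the integral of [f * (s - 1)] into the difference of the two integrals
    of [f], and the quadratic error is at most [2 * M ^+ 2]. *)
Lemma le_KL d (T : measurableType d) (R : realType) (a b : probability T R)
    (f : T -> R) (M : R) :
  measurable_fun setT f -> (forall x, `|f x| <= M) -> M <= 2^-1 ->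
  (((\int[a]_x f x) - (\int[b]_x f x) - 2 * M ^+ 2)%:E <= KL a b)%E.
Proof.
move=> mf fM M2.
have bf := bounded_fun_le fM.
rewrite /KL /divergence; case: ifPn => [/asboolP ab|_]; last by rewrite leey.
set RN := Radon_Nikodym _ _; pose s x := fine (RN x).
have RNE x : RN x = (s x)%:E by rewrite fineK// Radon_Nikodym_fin_num.
have iRN : b.-integrable setT (EFin \o s).
  rewrite (_ : EFin \o s = RN); first exact: Radon_Nikodym_integrable.
  by apply/funext => x /=; rewrite RNE.
have ms : measurable_fun setT s by apply/measurable_EFinP; exact: measurable_int iRN.
pose F x : R := s x * ln (s x) - s x + 1.
have mF : measurable_fun setT F.
  apply: measurable_funD => //; apply: measurable_funB => //.
  by apply: measurable_funM => //; apply: measurableT_comp => //; exact: measurable_ln.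
have F0 x : 0 <= F x.
  have := @mulr_sub1_le_entropy R (s x) 0.
  by rewrite normr0 mul0r expr0n mulr0 addr0; apply; lra.
(* An infinite entropy integral makes the bound trivial; otherwise nonnegativity (the entropy
   inequality at [u = 0]) makes [F] integrable. *)
have [Foo|] := boolP ((\int[b]_x (F x)%:E)%E < +oo)%E; last first.
  by rewrite -leNgt leye_eq => /eqP ->; rewrite leey.
have iF : b.-integrable setT (EFin \o F).
  apply/integrableP; split; first exact/measurable_EFinP.
  by under eq_integral do rewrite /= ger0_norm//.
have iaf := bounded_probability_integrable a mf bf.
have ibf := bounded_probability_integrable b mf bf.
have ifs : b.-integrable setT (EFin \o (f \* s)).
  by have := integrableMr measurableT mf bf iRN.
have Efs : \int[a]_x f x = \int[b]_x (f x * s x).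
  rewrite /Rintegral -(Radon_Nikodym_change_of_variables ab measurableT iaf).
  by congr fine; apply: eq_integral => x _; rewrite /= -/RN RNE.
have iM : b.-integrable setT (EFin \o cst (2 * M ^+ 2)).
  by apply: bounded_probability_integrable => //; exact: bounded_cst.
have ifsf : b.-integrable setT (EFin \o (fun x => f x * s x - f x)).
  exact: (integrableB measurableT ifs ibf).
have EM : 2 * M ^+ 2 = \int[b]_x cst (2 * M ^+ 2) x.
  by rewrite Rintegral_cst// [X in fine X]probability_setT mulr1.
rewrite Efs {1}EM -RintegralB// -RintegralB//.
rewrite /Rintegral fineK; last first.
  by apply: integrable_fin_num => //; exact: (integrableB measurableT ifsf iM).
apply: le_integral => //; first exact: (integrableB measurableT ifsf iM).
move=> x _; rewrite lee_fin /=.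
have M0 : 0 <= M by exact: le_trans (fM x).
have := @mulr_sub1_le_entropy R (s x) (f x) (le_trans (fM x) M2).
have : f x ^+ 2 <= M ^+ 2.
  by rewrite -[f x ^+ 2]ger0_norm ?sqr_ge0// normrX lerXn2r ?nnegrE.
by rewrite /F -/(s x) => h1 h2; lra.
Qed.

Lemma KL_ge0 d (T : measurableType d) (R : realType) (a b : probability T R) :
  (0 <= KL a b)%E.
Proof.
have := @le_KL _ _ _ a b (cst 0) 0 (measurable_cst _).
rewrite !Rintegral_cst// !mul0r expr0n mulr0 !subr0; apply; last lra.
by move=> x; rewrite normr0.
Qed.

(* [le_KL] for the multiples of [f], with a near-optimal factor. *)
Lemma KL_lower_bound d (T : measurableType d) (R : realType)
    (f : T -> R) (M e : R) :
  measurable_fun setT f -> (forall x, `|f x| <= M) -> 0 < M -> 0 < e ->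
  exists2 c : R, 0 < c & forall a b : probability T R,
    e <= `|(\int[a]_x f x) - \int[b]_x f x| -> (c%:E <= KL a b)%E.
Proof.
(* The first entry keeps [t * f] within the range of the entropy inequality; the second keeps the
   error [2 * (t * M) ^+ 2] below half of the gain [t * e]. *)
move=> mf fM M0 e0; pose t := Num.min (2 * M)^-1 (e / (4 * M ^+ 2)).
have t0 : 0 < t by rewrite lt_min invr_gt0 divr_gt0 ?mulr_gt0 ?exprn_gt0.
have tM : t * M <= 2^-1.
  apply: (@le_trans _ _ ((2 * M)^-1 * M)); first by rewrite ler_pM2r// ge_min lexx.
  by rewrite invfM -mulrA mulVf ?mulr1// gt_eqF.
have te : 2 * (t * M) ^+ 2 <= t * e / 2.
  have : t * (4 * M ^+ 2) <= e.
    by rewrite -ler_pdivlMr ?mulr_gt0 ?exprn_gt0// ge_min lexx orbT.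
  move=> h; have := ler_wpM2l (ltW t0) h; nra.
exists (t * e / 2); first by rewrite divr_gt0 ?mulr_gt0.
have bf := bounded_fun_le fM.
move=> a b; set I := \int[a]_x f x; set J := \int[b]_x f x => eIJ.
(* The factor [u] is [t] or [- t], following the sign of [I - J]. *)
have key u : `|u| = t -> t * e <= u * (I - J) -> ((t * e / 2)%:E <= KL a b)%E.
  move=> ut h; apply: le_trans (@le_KL _ _ _ a b (fun x => u * f x) (t * M) _ _ tM).
  - rewrite !RintegralZl//; try exact: bounded_probability_integrable.
    rewrite lee_fin -/I -/J; nra.
  - exact: measurable_funM.
  - by move=> x; rewrite normrM ut ler_pM2l.
have [IJ|IJ] := leP 0 (I - J).
  by apply: (key t); rewrite ?gtr0_norm// ler_pM2l// -[leRHS]ger0_norm.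
apply: (key (- t)); first by rewrite normrN gtr0_norm.
by rewrite mulNr -mulrN ler_pM2l// -ltr0_norm.
Qed.

(** * Bounded continuous functions determine a probability measure *)

(** Dominated convergence with bound 1: the truncations tend pointwise to the indicator of the
    positivity set, being constant once [k] exceeds [(g x)^-1]. *)
Lemma cvg_truncated_cozero (R : realType) d (T : measurableType d)
    (P : probability T R) (g : T -> R) :
  measurable_fun setT g -> (forall x, 0 <= g x) ->
  (\int[P]_x (Num.min 1 (k%:R * g x))%:E)%E @[k --> \oo] -->
    P [set x | 0 < g x].
Proof.
move=> mg g0; set A := [set x | _].
have mA : measurable A.
  rewrite [A](_ : _ = setT `&` g @^-1` `]0, +oo[); first exact: mg.
  by apply/seteqP; split=> x; rewrite /A /= in_itv/= andbT//; case.
rewrite -[P A](_ : \int[P]_x (\1_A x)%:E = _)%E; last first.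
  by rewrite integral_indic// setIT.
apply: (@dominated_cvg _ _ _ _ _ measurableT _ _ (cst 1%E)) => //.
- move=> k; apply/measurable_EFinP; apply: measurable_minr => //.
  exact: measurable_funM.
- move=> x _; apply: cvg_EFin; first exact: nearW.
  rewrite indicE; have [gx|gx] := boolP (x \in A); last first.
    move: gx; rewrite notin_setE => /negP; rewrite -leNgt => gx.
    have -> : g x = 0 by apply/le_anti; rewrite gx g0.
    under [X in X @ _]eq_fun do rewrite mulr0 min_r//.
    exact: cvg_cst.
  rewrite inE /A/= in gx.
  apply: cvg_near_cst; near=> k; apply: min_l.
  rewrite -ler_pdivrMr// div1r; near: k; exact: nbhs_infty_ger.
- by apply: finite_measure_integrable_cst.
- move=> k x _; rewrite lee_fin ger0_norm ?ge_min ?lexx//.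
  by rewrite le_min ler01/= mulr_ge0.
Unshelve. all: by end_near. Qed.

(** Open sets are stable under intersection and generate the sigma-algebra. On an open set, written
    as a positivity set, both measures are limits of integrals of the same bounded continuous
    truncations. *)
Lemma probability_rV_unique (R : realType) n (a b : probability 'rV[R]_n R) :
  (forall f : 'rV[R]_n -> R, continuous f -> bounded_fun f ->
    \int[a]_x f x = \int[b]_x f x) ->
  forall A, measurable A -> a A = b A.
Proof.
move=> ab; apply: (measure_unique (@open 'rV[R]_n) (fun=> setT)) => //.
- exact: openI.
- by move=> _; exact: openT.
- by rewrite bigcup_const//; exists 0%N.
- move=> A oA; have [g cg [g0 Ag]] := open_cozero oA.
  have -> : A = [set x | 0 < g x] by apply/seteqP; split=> x /Ag.
  have mg := continuous_rV_measurable cg.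
  have Lim (P : probability 'rV[R]_n R) :
      limn (fun k => \int[P]_x (Num.min 1 (k%:R * g x))%:E)%E =
      P [set x | 0 < g x].
    by apply: cvg_lim => //; exact: cvg_truncated_cozero.
  apply: etrans (esym (Lim a)) _; apply: etrans (Lim b).
  congr (limn _); apply/funext => k.
  pose f x : R := Num.min 1 (k%:R * g x).
  have cf : continuous f.
    move=> x; apply: (@continuous_min R _ (cst 1) (fun x => k%:R * g x)).
      exact: cst_continuous.
    by apply: continuousM; [exact: cst_continuous|exact: cg].
  have bf : bounded_fun f.
    apply: (@bounded_fun_le _ _ _ 1) => x.
    by rewrite ger0_norm /f ?ge_min ?lexx// le_min ler01/= mulr_ge0.
  have If (P : probability 'rV[R]_n R) :
      (\int[P]_x (f x)%:E = (\int[P]_x f x)%R%:E)%E.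
    rewrite /Rintegral fineK// integrable_fin_num//.
    exact: bounded_probability_integrable (continuous_rV_measurable cf) bf.
  by rewrite !If ab.
- by move=> _; rewrite -ge0_fin_numE// fin_num_measure.
Qed.

(** * The divergence of the hard marginal constraint *)

Section iota_divergence.
Context d (T : measurableType d) (R : realType).
Implicit Types a b : probability T R.
Local Open Scope ereal_scope.

Let iota_ge0 (s : R) : 0 <= iota_constraint s.
Proof. by rewrite /iota_constraint; case: ifP. Qed.

Let measurable_density a b : a `<< b ->
  measurable_fun setT (fun x =>
    fine (Radon_Nikodym (charge_of_finite_measure a) b x)).
Proof.
by move=> ab; apply: measurableT_comp.
Qed.

Let measurable_iota (s : T -> R) : measurable_fun setT s ->
  measurable_fun setT (fun x => iota_constraint (s x)).
Proof.
by move=> ms; apply: measurable_fun_ifT => //; exact: measurable_fun_eqr.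
Qed.

Lemma divergence_iota_ge0 a b : 0 <= divergence iota_constraint a b.
Proof.
by rewrite /divergence; case: ifPn => // _; exact: integral_ge0.
Qed.

(** The density and the constant 1 have equal [b]-integrals over every measurable set, so they agree
    almost everywhere. *)
Lemma divergence_iota_eq a b : (forall A, measurable A -> a A = b A) ->
  divergence iota_constraint a b = 0.
Proof.
move=> eab; have ab : a `<< b.
  by apply/null_content_dominatesP => A mA; rewrite eab.
rewrite /divergence asboolT//.
rewrite (ae_eq_integral (cst 0)) ?integral0//.
  exact/measurable_iota/measurable_density.
have : ae_eq b setT (Radon_Nikodym (charge_of_finite_measure a) b) (cst 1).
  apply: integral_ae_eq => //; first exact: Radon_Nikodym_integrable.
  move=> E _ mE; rewrite -Radon_Nikodym_integral//.
  by rewrite integral_cst// mul1e; exact: eab.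
by apply: filterS => x /= /[apply] ->; rewrite /iota_constraint eqxx.
Qed.

(** A finite integral forces its integrand to be finite almost everywhere, so the density is 1
    almost everywhere; both integrands vanish there. *)
Lemma divergence_iota_lty a b :
  divergence iota_constraint a b < +oo ->
  divergence iota_constraint a b = 0 /\ KL a b = 0.
Proof.
rewrite /KL /divergence; case: ifPn => [/asboolP ab doo|]; last by rewrite ltxx.
have ms := measurable_density ab; set s := fun x => fine _ in ms doo *.
have s1 : {ae b, forall x, s x = 1%R}.
  have : b.-integrable setT (fun x => iota_constraint (s x)).
    apply/integrableP; split; first exact: measurable_iota.
    by under eq_integral do rewrite gee0_abs//.
  move=> /(integrable_ae measurableT); apply: filterS => x /= /(_ I).
  by rewrite /iota_constraint; case: ifPn => // /eqP.
split; rewrite (ae_eq_integral (cst 0)) ?integral0//.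
- exact: measurable_iota.
- by apply: filterS s1 => x sx _; rewrite -/(s x) sx /iota_constraint eqxx.
- apply/measurable_EFinP; apply: measurable_funD => //.
  apply: measurable_funB => //; apply: measurable_funM => //.
  by apply: measurableT_comp => //; exact: measurable_ln.
- by apply: filterS s1 => x sx _; rewrite /KL_integrand -/(s x) sx ln1 mulr0 sub0r addNr.
Qed.

End iota_divergence.

(** * Weak convergence: transport cost and marginals *)

Section weak_convergence.
Context {R : realType} {n : nat}.
Notation E := 'rV[R]_n.
Implicit Types (u : nat -> P2_space R n) (x : P2_space R n).

(** Integration of [f] is a coordinate projection composed with [integrate_Cb], which is continuous
    by definition of the initial topology. *)
Lemma weak_cvg_integral u x (f : E * E -> R) : continuous f -> bounded_fun f ->
  u @ \oo --> x ->
  (\int[sval (u k)]_z f z)%R @[k --> \oo] --> (\int[sval x]_z f z)%R.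
Proof.
move=> cf bf ux; pose F : Cb (E * E)%type R := exist _ f (conj cf bf).
have : (integrate_Cb (u k) : prod_topology (fun _ : Cb (E * E)%type R => R))
    @[k --> \oo] --> integrate_Cb x.
  by apply: continuous_cvg ux; exact: initial_continuous.
by move=> /(cvg_comp _ _)/(_ (@proj_continuous _ (fun=> R : topologicalType) F _)).
Qed.

Lemma sqnorm_continuous : continuous (@sqnorm R n).
Proof.
apply: continuous_big => [|i _] v; first exact: add_continuous.
by apply: continuousM; exact: coord_continuous.
Qed.

Lemma cost_continuous : continuous (@cost R n).
Proof.
move=> z; apply: (@continuous_comp _ _ _ (fun z : E * E => z.1 - z.2)).
  by apply: cvgB; [exact: cvg_fst|exact: cvg_snd].
exact: sqnorm_continuous.
Qed.

Lemma cost_ge0 (z : E * E) : 0 <= cost z.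
Proof. by rewrite sumr_ge0// => i _; rewrite sqr_ge0. Qed.

Lemma measurable_cost : measurable_fun [set: E * E] (@cost R n).
Proof.
apply: measurable_sum => i; apply: measurable_funX.
under eq_fun do rewrite !mxE.
by apply: measurable_funB;
  [exact: (measurableT_comp (measurable_coord i) measurable_fst)
  |exact: (measurableT_comp (measurable_coord i) measurable_snd)].
Qed.

(** Weak convergence applies to the cost truncated at a level [k]; monotone convergence then removes
    the truncation. The majorant [e] is arbitrary so that the full energies can be used. *)
Lemma cost_lower_semicontinuous u x (e : (\bar R)^nat) :
  u @ \oo --> x -> (forall k, \int[sval (u k)]_z (cost z)%:E <= e k)%E ->
  (\int[sval x]_z (cost z)%:E <= limn_einf e)%E.
Proof.
move=> ux ue; pose c (k : nat) (z : E * E) : R := Num.min (cost z) k%:R.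
have c0 k z : 0 <= c k z by rewrite le_min cost_ge0 ler0n.
have mc k : measurable_fun setT (c k).
  by apply: measurable_minr => //; exact: measurable_cost.
have cc k : continuous (c k).
  move=> z; apply: (@continuous_min R _ (@cost R n) (cst k%:R)).
    exact: cost_continuous.
  exact: cst_continuous.
have bc k : bounded_fun (c k).
  apply: (@bounded_fun_le _ _ _ k%:R) => z.
  by rewrite ger0_norm// ge_min lexx orbT.
have Ic k (P : probability (E * E)%type R) :
    (\int[P]_z (c k z)%:E = (\int[P]_z c k z)%R%:E)%E.
  rewrite /Rintegral fineK// integrable_fin_num//.
  exact: bounded_probability_integrable.
have ck k : (\int[sval x]_z (c k z)%:E <= limn_einf e)%E.
  apply: (@le_cvg_limn_einf _ _ (fun m => \int[sval (u m)]_z (c k z)%:E)%E).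
    rewrite Ic; under eq_fun do rewrite Ic.
    by apply: cvg_EFin; [exact: nearW|exact: weak_cvg_integral].
  apply: nearW => m; apply: le_trans (ue m); apply: ge0_le_integral => //.
  - by move=> z _; rewrite lee_fin c0.
  - exact/measurable_EFinP.
  - by apply/measurable_EFinP; exact: measurable_cost.
  - by move=> z _; rewrite lee_fin ge_min lexx.
have cvc : (\int[sval x]_z (c k z)%:E)%E @[k --> \oo] -->
    (\int[sval x]_z (cost z)%:E)%E.
  rewrite [X in _ --> X](_ : _ =
      \int[sval x]_z limn (fun k => (c k z)%:E))%E; last first.
    apply: eq_integral => z _; apply/esym/cvg_lim => //.
    apply: cvg_near_cst; near=> k; congr EFin.
    by apply: min_l; near: k; exact: nbhs_infty_ger.
  apply: cvg_monotone_convergence => //.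
  - by move=> k; exact/measurable_EFinP.
  - by move=> k z _; rewrite lee_fin c0.
  - by move=> z _ k m km; rewrite lee_fin /c le_min !ge_min lexx ler_nat km orbT.
by apply: cvge_to_le cvc _; exact: nearW.
Unshelve. all: by end_near. Qed.

(** A map [p] covers both projections. Weak convergence, tested on [f \o p], keeps the marginals of
    [u k] away from [mu] by a fixed gap, which [KL_lower_bound] turns into a constant independent of
    [k]. *)
Lemma marginal_KL_lower_bound (p : {mfun (E * E)%type >-> E}) (mu : probability E R) u x :
  continuous p -> u @ \oo --> x ->
  divergence iota_constraint (distribution (sval x) p) mu != 0%E ->
  exists2 c : R, 0 < c &
    \forall k \near \oo, (c%:E <= KL (distribution (sval (u k)) p) mu)%E.
Proof.
move=> cp ux /eqP D0.
have [f [cf bf fN]] : exists f : E -> R, [/\ continuous f, bounded_fun f &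
    \int[distribution (sval x) p]_y f y <> \int[mu]_y f y].
  (* If no such [f] existed, the two measures would coincide and the constraint term would be 0. *)
  apply: contrapT => H; apply: D0; apply: divergence_iota_eq.
  apply: probability_rV_unique => f cf bf; apply: contrapT => fN.
  by apply: H; exists f.
have mf := continuous_rV_measurable cf.
have [M M0 fM] : exists2 M : R, 0 < M & forall y, `|f y| <= M.
  (* [bounded_fun] gives bounds only strictly above [N], hence the added 1; the maximum with 0
     ensures positivity. *)
  have [N [_ fN']] := bf; exists (Num.max N 0 + 1).
    by rewrite ltr_wpDl// le_max lexx orbT.
  by move=> y; apply: fN' => //; rewrite ltr_pwDr// le_max lexx.
have bfp : bounded_fun (f \o p) by apply: bounded_fun_le => z; exact: fM.
have If (P : probability (E * E)%type R) :
    \int[distribution P p]_y f y = \int[P]_z (f \o p) z.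
  rewrite /Rintegral integral_distribution//; first exact/measurable_EFinP.
  apply: bounded_probability_integrable => //.
  exact: measurableT_comp.
have cvgf := weak_cvg_integral (fun z => continuous_comp (cp z) (cf (p z))) bfp ux.
set J := \int[mu]_y f y in fN.
set I := \int[sval x]_z (f \o p) z in cvgf; rewrite If -/I in fN.
(* Half of the gap in the limit: once the integrals are within [e] of [I], they stay at distance at
   least [e] from [J]. *)
pose e := `|I - J| / 2.
have e0 : 0 < e by rewrite divr_gt0// normr_gt0 subr_eq0; exact/eqP.
have [c c0 Hc] := KL_lower_bound mf fM M0 e0.
move/cvgrPdist_lt : cvgf => /(_ _ e0) cvgf.
exists c => //; near=> k; apply: Hc; rewrite If -/J.
have : `|I - \int[sval (u k)]_z (f \o p) z| < e.
  by near: k; exact: cvgf.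
set K := \int[_]_z _ => IK.
have : `|I - J| <= `|I - K| + `|K - J|.
  by rewrite (_ : I - J = (I - K) + (K - J)) ?ler_normD//; ring.
rewrite /e in IK *; move=> ?; lra.
Unshelve. all: by end_near. Qed.

End weak_convergence.

(** * Upper and lower bounds for Gamma-convergence *)

Theorem theorem7 (R : realType) (d : nat) (mu nu : probability 'rV[R]_d R)
    (Lam : nat -> R)
    (mu_P2 : P2_rV mu) (nu_P2 : P2_rV nu)
    (LSI : exists2 K : R, 0 < K & log_Sobolev K mu \/ log_Sobolev K nu)
    (Lam_gt0 : forall n, 0 < Lam n)
    (Lam_incr : {homo Lam : m n / (m <= n)%N >-> m <= n})
    (Lam_cvg : Lam n @[n --> \oo] --> +oo) :
  Gamma_cvg
    (fun n (g : P2_space R d) => energy_KL (Lam n) mu nu (sval g))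
    (fun g : P2_space R d => energy_iota mu nu (sval g)).
Proof.
have I0 (P : probability ('rV[R]_d * 'rV[R]_d)%type R) :
    (0 <= \int[P]_z (cost z)%:E)%E.
  by apply: integral_ge0 => z _; rewrite lee_fin cost_ge0.
have LKL0 k (a b : probability 'rV[R]_d R) : (0 <= (Lam k)%:E * KL a b)%E.
  by rewrite mule_ge0// ?KL_ge0// lee_fin ltW.
split=> [x|x u ux].
  exists (fun=> x); first exact: cvg_cst.
  (* When [E0] is finite, both constraint terms are finite, hence they and the [KL] terms are 0, and
     the energy of [x] equals [E0] for every [k]. *)
  set E0 := energy_iota _ _ _; have [->|E0y] := eqVneq E0 +oo%E; first by rewrite leey.
  suff -> : (fun k => energy_KL (Lam k) mu nu (sval x)) = cst E0.
    by rewrite (cvg_limn_einf_sup (cvg_cst _)).2.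
  move: E0y; rewrite -ltey => E0y.
  have D1y : (divergence iota_constraint (marginal1 (sval x)) mu < +oo)%E.
    apply: le_lt_trans E0y; rewrite /E0 /energy_iota -addeA addeCA.
    by rewrite leeDl// adde_ge0// divergence_iota_ge0.
  have D2y : (divergence iota_constraint (marginal2 (sval x)) nu < +oo)%E.
    apply: le_lt_trans E0y; rewrite /E0 /energy_iota.
    by rewrite leeDr// adde_ge0// divergence_iota_ge0.
  apply/funext => k; rewrite /energy_KL /E0 /energy_iota /=.
  have [-> ->] := divergence_iota_lty D1y.
  by have [-> ->] := divergence_iota_lty D2y; rewrite !mule0.
(* One violated marginal suffices: its penalty alone is eventually at least [Lam k * c], which tends
   to [+oo]. *)
have escape (p : {mfun ('rV[R]_d * 'rV[R]_d)%type >-> 'rV[R]_d})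
    (m : probability 'rV[R]_d R) : continuous p ->
    (forall k, (Lam k)%:E * KL (distribution (sval (u k)) p) m <=
               energy_KL (Lam k) mu nu (sval (u k)))%E ->
    divergence iota_constraint (distribution (sval x) p) m != 0%E ->
    (energy_iota mu nu (sval x) <=
     limn_einf (fun k => energy_KL (Lam k) mu nu (sval (u k))))%E.
  move=> cp le_e D0; apply: (le_trans (leey _)).
  have [c c0 cKL] := marginal_KL_lower_bound cp ux D0.
  apply: (@le_cvg_limn_einf _ _ (fun k => (Lam k * c)%:E)).
    apply/cvgeryP; apply/cvgryPge => A.
    have /cvgryPge/(_ (A / c)) := Lam_cvg.
    by apply: filterS => k; rewrite ler_pdivrMr.
  apply: filterS cKL => k ck; apply: le_trans (le_e k).
  by rewrite EFinM lee_pmul2l// lte_fin.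
have [D1|D1] := eqVneq (divergence iota_constraint (marginal1 (sval x)) mu) 0%E;
  last first.
  apply: (escape [the {mfun _ >-> _} of fst] mu _ _ D1).
    by move=> z; exact: cvg_fst.
  by move=> k; rewrite /energy_KL -addeA addeCA leeDl// adde_ge0.
have [D2|D2] := eqVneq (divergence iota_constraint (marginal2 (sval x)) nu) 0%E;
  last first.
  apply: (escape [the {mfun _ >-> _} of snd] nu _ _ D2).
    by move=> z; exact: cvg_snd.
  by move=> k; rewrite /energy_KL leeDr// adde_ge0.
(* Both marginals are now as prescribed, so only the cost remains in the limit energy; the penalties
   along [u] are dropped by nonnegativity. *)
rewrite /energy_iota D1 D2 !adde0; apply: (cost_lower_semicontinuous ux) => k.
by rewrite /energy_KL -addeA leeDl// adde_ge0.
Qed.
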